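(* Let $a\ge b>0$ and $0<s<1$. Set $\alpha=1+\frac1s$ and $u_k^{-}=\frac{s(k+1)}{2(1-s)}$ for $k=0,1,2,\dots$. Then the series $$L_{(s)}^{-}=\frac{2\sqrt{a^2+b^2}}{1-s}\sum_{k=0}^{\infty}\frac{(-1)^k(\alpha)_k}{k!\,u_k^{-}}\left[{}_2F_1\left(-\tfrac12,1;u_k^{-}+1;\tfrac{b^2}{a^2+b^2}\right)+{}_2F_1\left(-\tfrac12,1;u_k^{-}+1;\tfrac{a^2}{a^2+b^2}\right)\right]$$ is Abel summable.
   Context: $(q)_k=\Gamma(q+k)/\Gamma(q)$ is the Pochhammer symbol and ${}_2F_1(A,B;C;z)=\sum_n\frac{(A)_n(B)_n}{(C)_n}\frac{z^n}{n!}$ is the Gauss hypergeometric function. A series $\sum_k c_k$ is Abel summable if $\sum_k c_k\varepsilon^k$ converges for every $0<\varepsilon<1$ and its limit as $\varepsilon\to1^-$ exists and is finite. *)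

(* Defs.v *)
From Stdlib Require Import Reals Factorial.
From Coquelicot Require Import Coquelicot.
Open Scope R_scope.

(* Euler-Gauss form: the limit of n! n^x / (x (x+1) ... (x+n)).  Unlike the
   Euler integral, it covers negative non-integer x, needed at x = -1/2.
   The value at the poles 0, -1, -2, ... is junk.  [prod_f_R0 f n] has the
   n+1 factors f 0, ..., f n. *)
Definition Gamma (x : R) : R :=
  real (Lim_seq (fun n : nat =>
    INR (fact n) * Rpower (INR n) x / prod_f_R0 (fun i : nat => x + INR i) n)).

Definition pochhammer (q : R) (k : nat) : R := Gamma (q + INR k) / Gamma q.

(* Meaningful only where the series converges, e.g. for |z| < 1 when none of
   A, B, C is in {0, -1, -2, ...}. *)
Definition hypergeom2F1 (A B C z : R) : R :=
  Series (fun n : nat =>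
    pochhammer A n * pochhammer B n / pochhammer C n * (z ^ n / INR (fact n))).

Definition Abel_summable (c : nat -> R) : Prop :=
  (forall eps : R, 0 < eps < 1 -> ex_series (fun k : nat => c k * eps ^ k)) /\
  exists l : R,
    filterlim (fun eps : R => Series (fun k : nat => c k * eps ^ k))
      (at_left 1) (locally l).

Definition alpha (s : R) : R := 1 + 1 / s.

Definition u_minus (s : R) (k : nat) : R := s * (INR k + 1) / (2 * (1 - s)).

(* The general term, with the constant in front of the sum distributed
   over the terms. *)
Definition L_minus_term (a b s : R) (k : nat) : R :=
  2 * sqrt (a ^ 2 + b ^ 2) / (1 - s) *
  ((-1) ^ k * pochhammer (alpha s) k / (INR (fact k) * u_minus s k) *
   (hypergeom2F1 (- (1 / 2)) 1 (u_minus s k + 1) (b ^ 2 / (a ^ 2 + b ^ 2)) +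
    hypergeom2F1 (- (1 / 2)) 1 (u_minus s k + 1) (a ^ 2 / (a ^ 2 + b ^ 2)))).

(* Main.v *)
Require Import Defs.
From Stdlib Require Import Reals.
From Coquelicot Require Import Coquelicot.
From Stdlib Require Import Factorial Lra Lia ClassicalEpsilon FunctionalExtensionality.
Open Scope R_scope.

(* Euler's integral with [B = 1], in a variable that turns [(1 - t) ^ u_k] into a
   multiple of [x ^ (k + 1)], writes the hypergeometric factor divided by [u_k] as
   the moment [RInt (fun x => x ^ k * phi x) 0 1] of a bounded function [phi]
   independent of [k].  Summing the binomial series under the integral, the Abel sum
   at [e] becomes the integral of [(1 + e x) ^ (- alpha) * phi x] over [0, 1], and the
   integrand converges uniformly as [e] tends to 1. *)

(** * The Gamma limit and rising factorials *)

(** Convexity of [exp]: the tangent at [x * d] lies below the graph at [0] and at [d], and these two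
    inequalities are combined with weights [1 - x] and [x]. With [exp d = (n + 2) / (n + 1)] this
    gives the upper bound on Gamma quotients for [0 < x <= 1]. *)
Lemma exp_chord (x d : R) : 0 <= x <= 1 -> exp (x * d) <= 1 + x * (exp d - 1).
Proof.
  intros Hx.
  assert (H0 : exp 0 = exp (x * d) * exp (- (x * d))) by (rewrite <- exp_plus; f_equal; ring).
  assert (H1 : exp d = exp (x * d) * exp (d - x * d)) by (rewrite <- exp_plus; f_equal; ring).
  rewrite exp_0 in H0.
  pose proof (exp_pos (x * d)) as Hp.
  pose proof (exp_ineq1_le (- (x * d))) as E0.
  pose proof (exp_ineq1_le (d - x * d)) as E1.
  apply (Rmult_le_compat_l (exp (x * d))) in E0; [|lra].
  apply (Rmult_le_compat_l (exp (x * d))) in E1; [|lra].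
  rewrite <- H0 in E0. rewrite <- H1 in E1.
  nra.
Qed.

Definition Gamma_seq (x : R) (n : nat) : R :=
  INR (fact n) * Rpower (INR n) x / prod_f_R0 (fun i : nat => x + INR i) n.

Lemma prod_f_R0_pos (f : nat -> R) (n : nat) :
  (forall i, 0 < f i) -> 0 < prod_f_R0 f n.
Proof.
  intros H; induction n as [|n IH]; [apply H|].
  apply Rmult_lt_0_compat; auto.
Qed.

Lemma prod_f_R0_neq_0 (f : nat -> R) (n : nat) :
  (forall i, f i <> 0) -> prod_f_R0 f n <> 0.
Proof.
  intros H; induction n as [|n IH]; [apply H|].
  apply Rmult_integral_contrapositive_currified; auto.
Qed.

(** Both sides are the product of [x], [x + 1], ..., [x + n + 1]. *)
Lemma prod_f_R0_shift (x : R) (n : nat) :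
  x * prod_f_R0 (fun i => x + 1 + INR i) n =
  prod_f_R0 (fun i => x + INR i) n * (x + 1 + INR n).
Proof.
  induction n as [|n IH].
  - simpl; ring.
  - cbn [prod_f_R0]. rewrite <- Rmult_assoc, IH, !S_INR. ring.
Qed.

(** The functional equation of Gamma before the limit; the last factor is the defect, which tends to
    1. *)
Lemma Gamma_seq_shift (x : R) (n : nat) : (forall m, x + INR m <> 0) -> (0 < n)%nat ->
  Gamma_seq (x + 1) n = x * Gamma_seq x n * (INR n / (x + 1 + INR n)).
Proof.
  intros Hx Hn. apply lt_INR in Hn; simpl in Hn. unfold Gamma_seq.
  rewrite Rpower_plus, Rpower_1 by exact Hn.
  assert (H0 : x <> 0) by (specialize (Hx 0%nat); simpl in Hx; lra).
  assert (Hxn : x + 1 + INR n <> 0) by (specialize (Hx (S n)); rewrite S_INR in Hx; lra).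
  pose proof (prod_f_R0_neq_0 (fun i => x + INR i) n Hx) as Hp.
  assert (Hq : prod_f_R0 (fun i => x + 1 + INR i) n =
    prod_f_R0 (fun i => x + INR i) n * (x + 1 + INR n) / x)
    by (rewrite <- prod_f_R0_shift; field; exact H0).
  rewrite Hq. field. auto.
Qed.

Lemma INR_shift_ratio_lim (x : R) : is_lim_seq (fun n => INR n / (x + INR n)) 1.
Proof.
  apply is_lim_seq_ext_loc with (fun n => / (1 + x * / INR n)).
  - destruct (nfloor_ex (Rabs x) (Rabs_pos x)) as [N [_ HN]].
    exists (S N). intros n Hn. apply le_INR in Hn. rewrite S_INR in Hn.
    pose proof (pos_INR N).
    assert (0 < x + INR n) by (unfold Rabs in HN; destruct (Rcase_abs x); lra).
    field. repeat split; lra.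
  - evar_last.
    apply is_lim_seq_inv.
    apply is_lim_seq_plus'. apply is_lim_seq_const.
    apply (is_lim_seq_scal_l _ x (Finite 0)).
    apply (is_lim_seq_inv _ p_infty). apply is_lim_seq_INR. discriminate.
    simpl. intros E; injection E; lra.
    simpl. f_equal. field.
Qed.

(** The limit is required to be nonzero because [pochhammer] divides by [Gamma q]. *)
Definition Gamma_converges (x : R) : Prop :=
  exists l : R, l <> 0 /\ is_lim_seq (Gamma_seq x) l.

Lemma Gamma_seq_lim_succ (x l : R) : (forall m, x + INR m <> 0) ->
  is_lim_seq (Gamma_seq x) l -> is_lim_seq (Gamma_seq (x + 1)) (x * l).
Proof.
  intros Hx Hl.
  apply is_lim_seq_ext_loc with (fun n => x * Gamma_seq x n * (INR n / (x + 1 + INR n))).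
  - exists 1%nat. intros n Hn. symmetry. apply Gamma_seq_shift; auto.
  - replace (x * l) with (x * l * 1) by ring.
    apply is_lim_seq_mult'; [|apply INR_shift_ratio_lim].
    apply (is_lim_seq_scal_l _ x l), Hl.
Qed.

(** Solving the shift relation for [Gamma_seq x] carries convergence one unit to the left, hence to
    negative non-integers such as -1/2. *)
Lemma Gamma_converges_pred (x : R) : (forall m, x + INR m <> 0) ->
  Gamma_converges (x + 1) -> Gamma_converges x.
Proof.
  intros Hx [l [Hl Hlim]].
  assert (H0 : x <> 0) by (specialize (Hx 0%nat); simpl in Hx; lra).
  exists (/ x * l / 1). split.
  { unfold Rdiv. repeat apply Rmult_integral_contrapositive_currified; auto;
    apply Rinv_neq_0_compat; lra. }
  apply is_lim_seq_ext_loc with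
    (fun n => / x * Gamma_seq (x + 1) n / (INR n / (x + 1 + INR n))).
  - exists 1%nat. intros n Hn. rewrite Gamma_seq_shift by auto.
    apply lt_INR in Hn; simpl in Hn.
    assert (Hxn : x + 1 + INR n <> 0) by (specialize (Hx (S n)); rewrite S_INR in Hx; lra).
    field. repeat split; lra.
  - apply is_lim_seq_div'; [|apply INR_shift_ratio_lim|lra].
    apply (is_lim_seq_scal_l _ (/ x) l), Hlim.
Qed.

Lemma ln_div_succ_bounds (n : R) : 0 < n -> 1 / (n + 1) <= ln (n + 1) - ln n.
Proof.
  intros Hn.
  rewrite <- ln_div by lra.
  assert (H : 1 + ln (n / (n + 1)) <= n / (n + 1)).
  { rewrite <- (exp_ln (n / (n + 1))) at 2 by (apply Rdiv_lt_0_compat; lra).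
    apply exp_ineq1_le. }
  rewrite ln_div in H by lra. rewrite ln_div by lra.
  replace (1 / (n + 1)) with (1 - n / (n + 1)) by (field; lra). lra.
Qed.

(** The quotient of consecutive terms is [(n + 1) / (x + n + 1) * exp (x * d)] with
    [d = ln (n + 1) - ln n], and [exp (x * d) >= 1 + x * d >= 1 + x / (n + 1)]. *)
Lemma Gamma_seq_incr (x : R) (n : nat) : 0 < x -> (0 < n)%nat ->
  Gamma_seq x n <= Gamma_seq x (S n).
Proof.
  intros Hx Hn. apply lt_INR in Hn; simpl in Hn.
  unfold Gamma_seq. cbn [prod_f_R0].
  assert (Hi : forall i : nat, 0 < x + INR i) by (intros i; pose proof (pos_INR i); lra).
  pose proof (prod_f_R0_pos (fun i => x + INR i) n Hi) as Hp.
  pose proof (INR_fact_lt_0 n) as Hf.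
  rewrite fact_simpl, mult_INR, !S_INR. unfold Rpower.
  set (P := prod_f_R0 _ n) in *.
  set (d := ln (INR n + 1) - ln (INR n)).
  replace (x * ln (INR n + 1)) with (x * d + x * ln (INR n)) by (unfold d; ring).
  rewrite exp_plus.
  pose proof (exp_pos (x * ln (INR n))) as He.
  assert (Hd : 1 / (INR n + 1) <= d) by (apply ln_div_succ_bounds; lra).
  pose proof (exp_ineq1_le (x * d)) as E1.
  assert (E2 : (x + (INR n + 1)) / (INR n + 1) <= exp (x * d)).
  { apply Rle_trans with (2 := E1).
    replace ((x + (INR n + 1)) / (INR n + 1)) with (1 + x * (1 / (INR n + 1))) by (field; lra).
    nra. }
  replace ((INR n + 1) * INR (fact n) * (exp (x * d) * exp (x * ln (INR n))) /
     (P * (x + (INR n + 1)))) with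
    (INR (fact n) * exp (x * ln (INR n)) / P *
      ((INR n + 1) / (x + (INR n + 1)) * exp (x * d))) by (field; lra).
  rewrite <- (Rmult_1_r (_ / P)) at 1.
  apply Rmult_le_compat_l.
  - apply Rlt_le, Rdiv_lt_0_compat; [nra|exact Hp].
  - apply Rmult_le_reg_l with ((x + (INR n + 1)) / (INR n + 1)).
    + apply Rdiv_lt_0_compat; lra.
    + rewrite Rmult_1_r. apply Rle_trans with (1 := E2). right. field. lra.
Qed.

(* Replacing [n ^ x] by [(n + 1) ^ x] turns the increasing sequence [Gamma_seq x]
   into a decreasing one when [x <= 1]. *)
Lemma Gamma_seq_bound_aux (x : R) (n : nat) : 0 < x <= 1 ->
  INR (fact n) * Rpower (INR n + 1) x / prod_f_R0 (fun i => x + INR i) n <= / x.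
Proof.
  intros Hx.
  assert (Hi : forall i : nat, 0 < x + INR i) by (intros i; pose proof (pos_INR i); lra).
  induction n as [|n IH].
  - simpl. unfold Rpower. rewrite Rplus_0_l, ln_1, Rmult_0_r, exp_0. right. field. lra.
  - apply Rle_trans with (2 := IH). cbn [prod_f_R0].
    pose proof (prod_f_R0_pos (fun i => x + INR i) n Hi) as Hp.
    pose proof (INR_fact_lt_0 n) as Hf. pose proof (pos_INR n) as Hn.
    rewrite fact_simpl, mult_INR, !S_INR. unfold Rpower.
    set (P := prod_f_R0 _ n) in *.
    set (d := ln (INR n + 1 + 1) - ln (INR n + 1)).
    replace (x * ln (INR n + 1 + 1)) with (x * d + x * ln (INR n + 1)) by (unfold d; ring).
    rewrite exp_plus.
    pose proof (exp_pos (x * ln (INR n + 1))) as He.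
    assert (E2 : exp (x * d) <= (x + (INR n + 1)) / (INR n + 1)).
    { apply Rle_trans with (1 := exp_chord x d ltac:(lra)).
      unfold d. rewrite <- ln_div by lra.
      rewrite exp_ln by (apply Rdiv_lt_0_compat; lra). right. field. lra. }
    replace ((INR n + 1) * INR (fact n) * (exp (x * d) * exp (x * ln (INR n + 1))) /
       (P * (x + (INR n + 1)))) with
      (INR (fact n) * exp (x * ln (INR n + 1)) / P *
        ((INR n + 1) / (x + (INR n + 1)) * exp (x * d))) by (field; lra).
    rewrite <- (Rmult_1_r (_ / P)) at 2.
    apply Rmult_le_compat_l.
    + apply Rlt_le, Rdiv_lt_0_compat; [nra|exact Hp].
    + apply Rmult_le_reg_l with ((x + (INR n + 1)) / (INR n + 1)).
      * apply Rdiv_lt_0_compat; lra.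
      * rewrite Rmult_1_r. apply Rle_trans with (2 := E2). right. field. lra.
Qed.

Lemma Gamma_seq_pos (x : R) (n : nat) : 0 < x -> 0 < Gamma_seq x n.
Proof.
  intros Hx. unfold Gamma_seq, Rpower.
  apply Rdiv_lt_0_compat.
  - apply Rmult_lt_0_compat; [apply INR_fact_lt_0|apply exp_pos].
  - apply prod_f_R0_pos. intros i. pose proof (pos_INR i); lra.
Qed.

Lemma Gamma_converges_unit (x : R) : 0 < x <= 1 -> Gamma_converges x.
Proof.
  intros Hx.
  (* The sequence is taken from index 1 on: since [ln 0 = 0], [Rpower 0 x] is 1 and the term at 0
     has the spurious value [/ x]. *)
  destruct (ex_finite_lim_seq_incr (fun n => Gamma_seq x (S n)) (/ x)) as [l Hl].
  - intros n. apply Gamma_seq_incr; [lra|lia].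
  - intros n. apply Rle_trans with (2 := Gamma_seq_bound_aux x (S n) Hx).
    unfold Gamma_seq, Rdiv. apply Rmult_le_compat_r.
    + apply Rlt_le, Rinv_0_lt_compat, prod_f_R0_pos.
      intros i. pose proof (pos_INR i); lra.
    + apply Rmult_le_compat_l; [apply pos_INR|].
      pose proof (pos_INR n).
      apply Rle_Rpower_l; [lra|]. rewrite S_INR. lra.
  - exists l. split; [|apply is_lim_seq_incr_1, Hl].
    (* An increasing sequence stays below its limit, so the positive term at index 1 keeps the limit
       away from zero. *)
    pose proof (Gamma_seq_pos x 1 ltac:(lra)) as Hpos.
    pose proof (is_lim_seq_incr_compare _ l Hl
      (fun n => Gamma_seq_incr x (S n) ltac:(lra) ltac:(lia)) 0%nat) as H. simpl in H. lra.
Qed.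

Lemma Gamma_converges_pos (m : nat) (x : R) : INR m < x <= INR m + 1 -> Gamma_converges x.
Proof.
  revert x; induction m as [|m IH]; intros x Hx.
  - apply Gamma_converges_unit. simpl in Hx. lra.
  - rewrite S_INR in Hx. pose proof (pos_INR m) as Hm.
    destruct (IH (x - 1) ltac:(lra)) as [l [Hl Hlim]].
    exists ((x - 1) * l). split.
    + apply Rmult_integral_contrapositive_currified; lra.
    + replace x with (x - 1 + 1) at 1 by ring.
      apply Gamma_seq_lim_succ; auto. intros i. pose proof (pos_INR i). lra.
Qed.

Lemma Gamma_converges_of_regular (x : R) : (forall m, x + INR m <> 0) -> Gamma_converges x.
Proof.
  intros Hx.
  (* Induction on a number of unit steps that brings [y] into the positive half-line. *)
  assert (Hneg : forall m y, (forall i, y + INR i <> 0) -> 0 < y + INR m -> Gamma_converges y).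
  { induction m as [|m IH]; intros y Hy Hpos.
    - simpl in Hpos.
      destruct (nfloor1_ex y ltac:(lra)) as [n Hn].
      apply (Gamma_converges_pos n). lra.
    - rewrite S_INR in Hpos. apply Gamma_converges_pred; [exact Hy|].
      apply IH; [|lra]. intros i. specialize (Hy (S i)). rewrite S_INR in Hy. lra. }
  destruct (nfloor_ex (Rabs x) (Rabs_pos x)) as [N [_ HN]].
  apply (Hneg (S N)); [exact Hx|]. rewrite S_INR.
  unfold Rabs in HN; destruct (Rcase_abs x); lra.
Qed.

Lemma Gamma_neq_0 (x : R) : (forall m, x + INR m <> 0) -> Gamma x <> 0.
Proof.
  intros Hx. destruct (Gamma_converges_of_regular x Hx) as [l [Hl Hlim]].
  unfold Gamma. change (real (Lim_seq (Gamma_seq x)) <> 0).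
  rewrite (is_lim_seq_unique _ _ Hlim). exact Hl.
Qed.

Lemma Gamma_succ (x : R) : (forall m, x + INR m <> 0) -> Gamma (x + 1) = x * Gamma x.
Proof.
  intros Hx. destruct (Gamma_converges_of_regular x Hx) as [l [Hl Hlim]].
  unfold Gamma.
  change (real (Lim_seq (Gamma_seq (x + 1))) = x * real (Lim_seq (Gamma_seq x))).
  rewrite (is_lim_seq_unique _ _ Hlim),
    (is_lim_seq_unique _ _ (Gamma_seq_lim_succ x l Hx Hlim)). reflexivity.
Qed.

Fixpoint rising (q : R) (n : nat) : R :=
  match n with
  | 0%nat => 1
  | S m => rising q m * (q + INR m)
  end.

Lemma pochhammer_rising (q : R) (n : nat) : (forall m, q + INR m <> 0) ->
  pochhammer q n = rising q n.
Proof.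
  intros Hq. unfold pochhammer. pose proof (Gamma_neq_0 q Hq) as HG.
  assert (H : Gamma (q + INR n) = rising q n * Gamma q).
  { induction n as [|n IH].
    - simpl. rewrite Rplus_0_r. ring.
    - rewrite S_INR, <- Rplus_assoc, Gamma_succ, IH; [simpl; ring|].
      intros m. rewrite Rplus_assoc, <- plus_INR. apply Hq. }
  rewrite H. field. exact HG.
Qed.

Lemma rising_neq_0 (q : R) (n : nat) : (forall m, q + INR m <> 0) -> rising q n <> 0.
Proof.
  intros Hq; induction n as [|n IH]; simpl; [lra|].
  apply Rmult_integral_contrapositive_currified; auto.
Qed.

Lemma rising_1 (n : nat) : rising 1 n = INR (fact n).
Proof.
  induction n as [|n IH]; [reflexivity|].
  rewrite fact_simpl, mult_INR, S_INR, <- IH. simpl. ring.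
Qed.

(** * The binomial series *)

(** Taylor coefficients at 0 of [(1 - y) ^ (- q)]. *)
Definition binom_coef (q : R) (n : nat) : R := rising q n / INR (fact n).

(** This is [(1 - y) P' = q P] read coefficient by coefficient. *)
Lemma binom_coef_succ (q : R) (n : nat) :
  INR (S n) * binom_coef q (S n) = (q + INR n) * binom_coef q n.
Proof.
  unfold binom_coef. cbn [rising]. rewrite fact_simpl, mult_INR.
  pose proof (INR_fact_neq_0 n). pose proof (not_0_INR (S n) ltac:(lia)).
  field. auto.
Qed.

(** Ratio test: the hypothesis keeps every coefficient nonzero, and consecutive quotients
    [(q + n) / (n + 1)] tend to 1. *)
Lemma CV_radius_binom_coef (q : R) : (forall m, q + INR m <> 0) ->
  CV_radius (binom_coef q) = 1.
Proof.
  intros Hq.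
  assert (Hn0 : forall n, binom_coef q n <> 0).
  { intros n. unfold binom_coef, Rdiv. apply Rmult_integral_contrapositive_currified.
    - apply rising_neq_0, Hq.
    - apply Rinv_neq_0_compat, INR_fact_neq_0. }
  rewrite (CV_radius_finite_DAlembert _ 1 Hn0 Rlt_0_1); [simpl; f_equal; field|].
  replace (Finite 1) with (Rbar_abs (Finite 1)) by (simpl; f_equal; apply Rabs_R1).
  apply is_lim_seq_abs.
  apply is_lim_seq_ext_loc with
    (fun n => / (INR n / (q + INR n)) * (INR n / (1 + INR n))).
  - exists 1%nat. intros n Hn. apply lt_INR in Hn; simpl in Hn.
    pose proof (Hq n). pose proof (Hn0 n).
    pose proof (binom_coef_succ q n) as E. rewrite S_INR in E.
    replace (binom_coef q (S n)) with ((q + INR n) * binom_coef q n / (INR n + 1))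
      by (rewrite <- E; field; lra).
    field. repeat split; lra.
  - replace (Finite 1) with (Finite (/ 1 * 1)) by (f_equal; field).
    apply is_lim_seq_mult'; [|apply INR_shift_ratio_lim].
    apply (is_lim_seq_inv _ 1); [apply INR_shift_ratio_lim|].
    intros E; injection E; lra.
Qed.

Lemma Rpower_derive_1_minus (q y : R) : y < 1 ->
  is_derive (fun t => Rpower (1 - t) q) y (- (q * Rpower (1 - y) q / (1 - y))).
Proof.
  intros Hy. unfold Rpower. auto_derive; [lra|]. unfold Rminus. field. lra.
Qed.

(* The differential equation [(1 - y) P' = q P] forces [P (1 - y)^q] to be constant. *)
Lemma PSeries_binom_coef (q y : R) : (forall m, q + INR m <> 0) -> Rabs y < 1 ->
  PSeries (binom_coef q) y = Rpower (1 - y) (- q).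
Proof.
  intros Hq Hy.
  set (P := PSeries (binom_coef q)).
  assert (HP : forall t, Rabs t < 1 -> is_derive P t (q * P t / (1 - t))).
  { intros t Ht.
    assert (Hr : Rbar_lt (Rabs t) (CV_radius (binom_coef q)))
      by (rewrite CV_radius_binom_coef; [exact Ht|exact Hq]).
    evar_last; [apply is_derive_PSeries, Hr|].
    set (D := PSeries (PS_derive (binom_coef q)) t).
    (* The coefficient recurrence is summed: [n * a_n] is the coefficient of index [n] in [t * P'],
       the derivative series shifted by one place. *)
    assert (Ed : D = q * P t + t * D).
    { unfold D at 1.
      rewrite (PSeries_ext _ (PS_plus (PS_scal q (binom_coef q))
        (PS_incr_1 (PS_derive (binom_coef q))))).
      - rewrite PSeries_plus, PSeries_scal, PSeries_incr_1; [reflexivity| |].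
        + apply ex_pseries_scal; [apply Rmult_comm|]. apply CV_radius_inside, Hr.
        + apply ex_pseries_incr_1, CV_radius_inside.
          rewrite CV_radius_derive. exact Hr.
      - intros n. unfold PS_plus, PS_scal, PS_derive.
        rewrite binom_coef_succ.
        destruct n as [|n]; simpl PS_incr_1.
        + unfold plus, scal, zero; simpl. unfold mult; simpl. ring.
        + change ((q + INR (S n)) * binom_coef q (S n) =
            q * binom_coef q (S n) + INR (S n) * binom_coef q (S n)). ring. }
    assert (t < 1) by (apply Rabs_lt_between in Ht; lra).
    apply Rmult_eq_reg_r with (1 - t); [|lra].
    unfold Rdiv. rewrite Rmult_assoc, Rinv_l by lra. lra. }
  assert (HF : forall t, Rabs t < 1 -> is_derive (fun t => P t * Rpower (1 - t) q) t 0).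
  { intros t Ht. evar_last.
    - apply (is_derive_mult P); [apply HP, Ht|apply Rpower_derive_1_minus|apply Rmult_comm].
      apply Rabs_lt_between in Ht; lra.
    - unfold plus, mult; simpl. apply Rabs_lt_between in Ht. field. lra. }
  assert (HF0 : P y * Rpower (1 - y) q = 1).
  { transitivity (P 0 * Rpower (1 - 0) q).
    2:{ unfold P. rewrite PSeries_0. unfold binom_coef, Rpower. simpl.
        rewrite Rminus_0_r, ln_1, Rmult_0_r, exp_0. field. }
    apply Rabs_lt_between in Hy.
    destruct (Rtotal_order y 0) as [H|[H|H]].
    - apply (eq_is_derive (fun t => P t * Rpower (1 - t) q)); [|exact H].
      intros t Ht. apply HF. apply Rabs_lt_between. lra.
    - subst y. reflexivity.
    - symmetry. apply (eq_is_derive (fun t => P t * Rpower (1 - t) q)); [|exact H].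
      intros t Ht. apply HF. apply Rabs_lt_between. lra. }
  rewrite Rpower_Ropp.
  apply Rmult_eq_reg_r with (Rpower (1 - y) q); [|unfold Rpower; pose proof (exp_pos (q * ln (1 - y))); lra].
  rewrite HF0. unfold Rpower. pose proof (exp_pos (q * ln (1 - y))). field. lra.
Qed.

(** * Exchanging limits and integrals *)

(* Coquelicot's [filterlim_RInt] wants uniform convergence on all of [R] and
   integrability for every parameter; cutting off outside the interval and outside
   the good parameters removes both restrictions. *)
Lemma is_RInt_uniform_limit {U : Type} (F : (U -> Prop) -> Prop) {FF : ProperFilter F}
  (f : U -> R -> R) (g : R -> R) (h : U -> R) :
  F (fun u => is_RInt (f u) 0 1 (h u)) ->
  (forall e : posreal, F (fun u => forall x, 0 <= x <= 1 -> Rabs (f u x - g x) < e)) ->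
  exists J : R, filterlim h F (locally J) /\ is_RInt g 0 1 J.
Proof.
  intros Hint Hunif.
  set (good := fun u => is_RInt (f u) 0 1 (h u)).
  set (cut := fun (k : R -> R) x =>
    if excluded_middle_informative (0 <= x <= 1) then k x else 0).
  assert (Hcut : forall (k : R -> R) l, is_RInt k 0 1 l <-> is_RInt (cut k) 0 1 l).
  { intros k l; split; apply is_RInt_ext; rewrite Rmin_left, Rmax_right by lra;
    intros x Hx; unfold cut; destruct excluded_middle_informative; lra. }
  set (f' := fun u => if excluded_middle_informative (good u) then cut (f u) else fun _ => 0).
  set (h' := fun u => if excluded_middle_informative (good u) then h u else 0).
  destruct (@filterlim_RInt U R_CompleteNormedModule f' 0 1 F FF (cut g) h') as [J [HJ HI]].
  - intros u. unfold f', h'. destruct excluded_middle_informative as [Hu|Hu].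
    + apply (proj1 (Hcut _ _)), Hu.
    + evar_last; [apply (@is_RInt_const R_NormedModule)|].
      unfold scal; simpl; unfold mult; simpl; ring.
  - apply filterlim_locally. intros e.
    generalize (filter_and _ _ Hint (Hunif e)). apply filter_imp.
    intros u [Hu He] x. unfold f'. destruct excluded_middle_informative as [_|n]; [|now elim n].
    unfold cut. destruct excluded_middle_informative as [Hx|Hx].
    + apply He, Hx.
    + apply ball_center.
  - exists J. split; [|apply (proj2 (Hcut _ _)), HI].
    apply filterlim_ext_loc with (2 := HJ).
    revert Hint. apply filter_imp. intros u Hu. unfold h'.
    destruct excluded_middle_informative; [reflexivity|now elim n].
Qed.

Lemma is_RInt_sum_n (f : nat -> R -> R) (l : nat -> R) (a b : R) (N : nat) :
  (forall n, is_RInt (f n) a b (l n)) ->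
  is_RInt (fun x => sum_n (fun n => f n x) N) a b (sum_n l N).
Proof.
  intros H. induction N as [|N IH].
  - rewrite sum_O. apply is_RInt_ext with (2 := H 0%nat). intros; now rewrite sum_O.
  - rewrite sum_Sn.
    apply is_RInt_ext with (fun x => plus (sum_n (fun n => f n x) N) (f (S N) x)).
    + intros; now rewrite sum_Sn.
    + apply (@is_RInt_plus R_NormedModule); auto.
Qed.

(** The error is a tail of [a], dominated termwise by the tail of [M]. The bound depends on [M]
    alone, so it is uniform when [a] depends on a point. *)
Lemma series_tail_bound (a M : nat -> R) (l : R) (N : nat) :
  (forall n, Rabs (a n) <= M n) -> ex_series M -> is_series a l ->
  Rabs (sum_n a N - l) <= Series M - sum_n M N.
Proof.
  intros Ha HM Hl.
  assert (Exa : ex_series (fun n => Rabs (a n))).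
  { apply (ex_series_le (fun n => Rabs (a n)) M); [|exact HM]. intros n. unfold norm; simpl. unfold abs; simpl.
    rewrite Rabs_Rabsolu. apply Ha. }
  rewrite <- (is_series_unique _ _ Hl).
  rewrite (Series_incr_n a (S N)) by (lia || (eexists; apply Hl)).
  rewrite (Series_incr_n M (S N)) by (lia || exact HM).
  simpl pred. rewrite <- !sum_n_Reals.
  replace (sum_n a N - _) with (- Series (fun k => a (S N + k)%nat)) by ring.
  replace (_ + _ - sum_n M N) with (Series (fun k => M (S N + k)%nat)) by ring.
  rewrite Rabs_Ropp.
  apply Rle_trans with (Series (fun k => Rabs (a (S N + k)%nat))).
  - apply Series_Rabs. now apply -> (ex_series_incr_n (fun n => Rabs (a n)) (S N)).
  - apply Series_le.
    + intros n; split; [apply Rabs_pos|apply Ha].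
    + now apply -> (ex_series_incr_n M (S N)).
Qed.

(** Weierstrass M-test: the partial sums converge uniformly on the interval, so the series may be
    integrated term by term. *)
Lemma is_RInt_series (f : nat -> R -> R) (g : R -> R) (I M : nat -> R) :
  (forall n x, 0 <= x <= 1 -> Rabs (f n x) <= M n) -> ex_series M ->
  (forall x, 0 <= x <= 1 -> is_series (fun n => f n x) (g x)) ->
  (forall n, is_RInt (f n) 0 1 (I n)) ->
  exists J, is_series I J /\ is_RInt g 0 1 J.
Proof.
  intros Hf HM Hg HI.
  apply (is_RInt_uniform_limit eventually (fun N x => sum_n (fun n => f n x) N) g (sum_n I)).
  - apply filter_forall. intros N. apply is_RInt_sum_n, HI.
  - intros e.
    generalize (proj1 (filterlim_locally (sum_n M) (Series M)) (Series_correct _ HM) e). apply filter_imp. intros N HN x Hx.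
    apply Rle_lt_trans with (Series M - sum_n M N).
    + apply series_tail_bound; auto.
    + change (Rabs (sum_n M N - Series M) < e) in HN.
      apply Rabs_lt_between in HN. lra.
Qed.

(** * Euler's integral *)

(* [Rpower 0 r = 1] because [ln 0 = 0]; this version vanishes at the origin. *)
Definition rpow (r x : R) : R := if Rle_dec x 0 then 0 else Rpower x r.

Lemma rpow_0 (r : R) : rpow r 0 = 0.
Proof. unfold rpow. destruct Rle_dec; lra. Qed.

Lemma rpow_1 (r : R) : rpow r 1 = 1.
Proof.
  unfold rpow. destruct Rle_dec; [lra|]. unfold Rpower. now rewrite ln_1, Rmult_0_r, exp_0.
Qed.

Lemma rpow_bounds (r x : R) : 0 < r -> 0 <= x <= 1 -> 0 <= rpow r x <= 1.
Proof.
  intros Hr Hx. unfold rpow. destruct Rle_dec; [lra|].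
  split; [apply Rlt_le, exp_pos|].
  rewrite <- (rpow_1 r). unfold rpow. destruct Rle_dec; [lra|].
  apply Rle_Rpower_l; lra.
Qed.

Lemma is_derive_rpow (r x : R) : 0 < x -> is_derive (rpow r) x (r * rpow r x / x).
Proof.
  intros Hx. apply is_derive_ext_loc with (fun t => Rpower t r).
  - exists (mkposreal x Hx). intros t Ht. change (Rabs (t - x) < x) in Ht.
    apply Rabs_lt_between in Ht. unfold rpow. destruct Rle_dec; [lra|reflexivity].
  - unfold rpow. destruct Rle_dec; [lra|]. unfold Rpower. auto_derive; [lra|]. field. lra.
Qed.

Lemma continuous_rpow (r x : R) : 0 < r -> 0 <= x -> continuous (rpow r) x.
Proof.
  intros Hr [Hx|<-].
  - apply (@ex_derive_continuous R_AbsRing R_NormedModule). eexists. apply is_derive_rpow, Hx.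
  - apply filterlim_locally. intros e. rewrite rpow_0.
    (* At the origin the radius [e ^ (1 / r)] works, since [t < e ^ (1 / r)] gives [t ^ r < e]. *)
    assert (Hd : 0 < Rpower e (/ r)) by apply exp_pos.
    exists (mkposreal _ Hd). intros t Ht. change (Rabs (t - 0) < Rpower e (/ r)) in Ht.
    change (Rabs (rpow r t - 0) < e). pose proof (cond_pos e) as He.
    rewrite Rminus_0_r in *. unfold rpow. destruct Rle_dec as [_|Hn].
    + rewrite Rabs_R0. exact He.
    + rewrite Rabs_pos_eq in Ht by lra.
      rewrite Rabs_pos_eq by (apply Rlt_le, exp_pos).
      replace (pos e) with (Rpower (Rpower e (/ r)) r).
      * apply Rlt_Rpower_l; lra.
      * rewrite Rpower_mult, Rinv_l, Rpower_1 by lra. reflexivity.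
Qed.

(** The difference quotient at 0 is [h] itself. This covers the endpoint 0, where [rpow r] fails to
    be differentiable for [r < 1]. *)
Lemma is_derive_id_mult_0 (h : R -> R) : continuous h 0 -> is_derive (fun x => x * h x) 0 (h 0).
Proof.
  intros Hh. apply is_derive_Reals. intros e He.
  destruct (proj1 (filterlim_locally _ _) Hh (mkposreal e He)) as [d Hd].
  exists d. intros t Ht0 Ht. rewrite Rplus_0_l, Rmult_0_l, Rminus_0_r.
  replace (t * h t / t) with (h t) by (field; exact Ht0).
  apply Hd. change (Rabs (t - 0) < d). now rewrite Rminus_0_r.
Qed.

(** With [y = x ^ r], its integral over [0, 1] becomes the Beta value
    [B((k + 1) / r, n + 1) / r]. *)
Definition beta_integrand (r : R) (k n : nat) (x : R) : R := x ^ k * (1 - rpow r x) ^ n.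

Lemma continuous_beta_integrand (r : R) (k n : nat) (x : R) : 0 < r -> 0 <= x ->
  continuous (beta_integrand r k n) x.
Proof.
  intros Hr Hx. apply (continuous_mult (fun x => x ^ k) (fun x => (1 - rpow r x) ^ n)).
  - apply (@ex_derive_continuous R_AbsRing R_NormedModule). auto_derive. trivial.
  - apply (continuous_comp (rpow r) (fun y => (1 - y) ^ n)).
    + apply continuous_rpow; assumption.
    + apply (@ex_derive_continuous R_AbsRing R_NormedModule). auto_derive. trivial.
Qed.

(** Writing [x ^ r] as [1 - (1 - x ^ r)] expresses the derivative through the integrands of index
    [n] and [n + 1] alone; integrating it yields a recurrence in [n]. *)
Lemma is_derive_beta_integrand (r : R) (k n : nat) (x : R) : 0 < r -> 0 <= x ->
  is_derive (fun x => x * beta_integrand r k (S n) x) x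
    ((INR k + 1 + (INR n + 1) * r) * beta_integrand r k (S n) x -
     (INR n + 1) * r * beta_integrand r k n x).
Proof.
  intros Hr [Hx|<-].
  - unfold beta_integrand.
    pose proof (is_derive_rpow r x Hx) as Hd. revert Hd. generalize (rpow r) as p.
    intros p Hd.
    auto_derive; [eexists; exact Hd|].
    replace (Derive (fun x0 => p x0) x) with (r * p x / x)
      by (symmetry; apply is_derive_unique, Hd).
    change (match n with 0%nat => 1 | S _ => INR n + 1 end) with (INR (S n)).
    rewrite S_INR. destruct k as [|k].
    + simpl. unfold Rminus. field. lra.
    + rewrite S_INR. simpl. unfold Rminus. field. lra.
  - evar_last.
    { apply is_derive_id_mult_0, continuous_beta_integrand; lra. }
    unfold beta_integrand. rewrite rpow_0, Rminus_0_r, !pow1.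
    destruct k as [|k]; simpl; ring.
Qed.

Lemma rising_succ_l (q : R) (n : nat) : rising q (S n) = q * rising (q + 1) n.
Proof.
  induction n as [|n IH]; [simpl; ring|].
  change (rising q (S n) * (q + INR (S n)) = q * (rising (q + 1) n * (q + 1 + INR n))).
  rewrite IH, S_INR. ring.
Qed.

Lemma rising_pos (q : R) (n : nat) : 0 < q -> 0 < rising q n.
Proof.
  intros Hq; induction n as [|n IH]; simpl; [lra|].
  pose proof (pos_INR n). apply Rmult_lt_0_compat; lra.
Qed.

Lemma is_RInt_beta_integrand (r : R) (k n : nat) : 0 < r ->
  is_RInt (beta_integrand r k n) 0 1
    (INR (fact n) / (r * rising ((INR k + 1) / r) (S n))).
Proof.
  intros Hr. pose proof (pos_INR k) as Hk.
  assert (Hu : 0 < (INR k + 1) / r) by (apply Rdiv_lt_0_compat; lra).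
  induction n as [|n IH].
  - evar_last.
    { apply (is_RInt_derive (fun x => x ^ S k / (INR k + 1))).
      - intros x _. auto_derive; [trivial|].
        change (match k with 0%nat => 1 | S _ => INR k + 1 end) with (INR (S k)).
        unfold beta_integrand. rewrite S_INR. simpl pow. field. lra.
      - rewrite Rmin_left, Rmax_right by lra. intros x Hx.
        apply continuous_beta_integrand; lra. }
    unfold minus, plus, opp; cbn -[INR pow]. rewrite pow1, pow_i by lia.
    simpl. field. lra.
  - pose proof (pos_INR n) as Hn.
    assert (Hc : 0 < INR k + 1 + (INR n + 1) * r) by nra.
    set (c := INR k + 1 + (INR n + 1) * r) in *.
    (* The primitive vanishes at both ends, at 0 by the factor [x] and at 1 by [1 - rpow r 1 = 0].
       Hence [c] times the integral of index [n + 1] is [(n + 1) * r] times that of index [n]. *)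
    assert (HD : is_RInt (fun x => c * beta_integrand r k (S n) x -
      (INR n + 1) * r * beta_integrand r k n x) 0 1 0).
    { evar_last.
      { apply (is_RInt_derive (fun x => x * beta_integrand r k (S n) x)).
        - rewrite Rmin_left, Rmax_right by lra. intros x Hx.
          apply is_derive_beta_integrand; lra.
        - rewrite Rmin_left, Rmax_right by lra. intros x Hx.
          apply (continuous_minus (V := R_NormedModule));
          apply (continuous_scal_r (V := R_NormedModule));
          apply continuous_beta_integrand; lra. }
      unfold beta_integrand. rewrite rpow_1, Rminus_diag, (pow_i (S n)) by lia.
      unfold minus, plus, opp; simpl. ring. }
    apply (is_RInt_scal _ _ _ ((INR n + 1) * r)) in IH.
    pose proof (is_RInt_plus _ _ _ _ _ _ HD IH) as HS.
    apply (is_RInt_scal _ _ _ (/ c)) in HS.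
    evar_last.
    { apply is_RInt_ext with (2 := HS). intros x _.
      unfold scal, plus; simpl. unfold mult; simpl. field. lra. }
    pose proof (rising_pos ((INR k + 1) / r) (S n) Hu) as Hp.
    rewrite fact_simpl, mult_INR, S_INR.
    change (rising ((INR k + 1) / r) (S (S n))) with
      (rising ((INR k + 1) / r) (S n) * ((INR k + 1) / r + INR (S n))).
    rewrite S_INR. set (P := rising _ _) in *.
    unfold scal, plus; simpl. unfold mult; simpl. unfold c in *.
    field. repeat split; nra.
Qed.

(** The factor [(1 - z t) ^ (- A)] of Euler's integral at [t = 1 - x ^ r], kept as a power series
    for termwise integration. *)
Definition euler_kernel (A r z x : R) : R := PSeries (binom_coef A) (z * (1 - rpow r x)).

(** The argument of the power series stays in [[0, z]], inside the disk of convergence, so the sum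
    of absolute values at [z] is a bound. *)
Lemma euler_kernel_bound (A r z : R) : (forall m, A + INR m <> 0) -> 0 < r -> 0 <= z < 1 ->
  exists M, forall x, 0 <= x <= 1 -> Rabs (euler_kernel A r z x) <= M.
Proof.
  intros HA Hr Hz.
  assert (Hdisk : forall y, 0 <= y <= z -> Rbar_lt (Rabs y) (CV_radius (binom_coef A))).
  { intros y Hy. rewrite CV_radius_binom_coef by exact HA. simpl. rewrite Rabs_pos_eq; lra. }
  exists (Series (fun n => Rabs (binom_coef A n * z ^ n))).
  intros x Hx. pose proof (rpow_bounds r x Hr Hx) as Hp.
  unfold euler_kernel, PSeries.
  assert (Hy : 0 <= z * (1 - rpow r x) <= z) by nra.
  apply Rle_trans with (1 := Series_Rabs _ (CV_disk_inside _ _ (Hdisk _ Hy))).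
  apply Series_le.
  - intros n. split; [apply Rabs_pos|]. rewrite !Rabs_mult.
    apply Rmult_le_compat_l; [apply Rabs_pos|].
    rewrite <- !RPow_abs. apply pow_incr. split; [apply Rabs_pos|].
    rewrite !Rabs_pos_eq; lra.
  - apply CV_disk_inside, Hdisk. lra.
Qed.

(* Euler's integral for the parameter [B = 1], in the variable [x = (1 - t) ^ (/ r)]. *)
Lemma hypergeom2F1_euler_moment (A r z : R) (k : nat) :
  (forall m, A + INR m <> 0) -> 0 < r -> 0 <= z < 1 ->
  is_RInt (fun x => x ^ k * euler_kernel A r z x) 0 1
    (hypergeom2F1 A 1 ((INR k + 1) / r + 1) z / (INR k + 1)).
Proof.
  intros HA Hr Hz. pose proof (pos_INR k) as Hk.
  set (u := (INR k + 1) / r).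
  assert (Hu : 0 < u) by (apply Rdiv_lt_0_compat; lra).
  assert (Hdisk : forall y, 0 <= y <= z -> Rbar_lt (Rabs y) (CV_radius (binom_coef A))).
  { intros y Hy. rewrite CV_radius_binom_coef by exact HA. simpl. rewrite Rabs_pos_eq; lra. }
  destruct (is_RInt_series
    (fun n x => binom_coef A n * z ^ n * beta_integrand r k n x)
    (fun x => x ^ k * euler_kernel A r z x)
    (fun n => binom_coef A n * z ^ n * (INR (fact n) / (r * rising u (S n))))
    (fun n => Rabs (binom_coef A n * z ^ n))) as [J [HJ HI]].
  - intros n x Hx. pose proof (rpow_bounds r x Hr Hx) as Hp.
    rewrite Rabs_mult. rewrite <- (Rmult_1_r (Rabs (_ * z ^ n))) at 2.
    apply Rmult_le_compat_l; [apply Rabs_pos|].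
    unfold beta_integrand.
    rewrite Rabs_pos_eq by (apply Rmult_le_pos; apply pow_le; lra).
    rewrite <- (Rmult_1_l 1) at 2.
    apply Rmult_le_compat; try (apply pow_le; lra).
    + rewrite <- (pow1 k). apply pow_incr. lra.
    + rewrite <- (pow1 n) at 2. apply pow_incr. lra.
  - apply CV_disk_inside, Hdisk. lra.
  - intros x Hx. pose proof (rpow_bounds r x Hr Hx) as Hp.
    apply is_series_ext with
      (fun n => x ^ k * (binom_coef A n * (z * (1 - rpow r x)) ^ n)).
    + intros n. unfold beta_integrand. rewrite Rpow_mult_distr.
      match goal with |- ?l = ?r => change (@eq R l r) end. ring.
    + apply (@is_series_scal R_AbsRing R_NormedModule (x ^ k)).
      apply is_pseries_R, PSeries_correct, CV_radius_inside, Hdisk. nra.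
  - intros n. apply (@is_RInt_scal R_NormedModule), is_RInt_beta_integrand, Hr.
  - replace (hypergeom2F1 A 1 (u + 1) z / (INR k + 1)) with J; [exact HI|].
    rewrite <- (is_series_unique _ _ HJ).
    transitivity (/ (INR k + 1) * hypergeom2F1 A 1 (u + 1) z); [|apply Rmult_comm].
    unfold hypergeom2F1. rewrite <- Series_scal_l.
    apply Series_ext. intros n.
    (* [(1)_n = n!] cancels the factorial in the series, and [r * (u)_(n+1) = r * u * (u + 1)_n]
       with [r * u = k + 1] accounts for the division by [k + 1]. *)
    rewrite !pochhammer_rising, rising_1, rising_succ_l.
    + pose proof (rising_pos (u + 1) n ltac:(lra)) as Hp.
      pose proof (INR_fact_neq_0 n).
      replace (INR k + 1) with (r * u) by (unfold u; field; lra).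
      unfold binom_coef. field. repeat split; lra.
    + intros m. pose proof (pos_INR m). lra.
    + intros m. pose proof (pos_INR m). lra.
    + exact HA.
Qed.

(** * Abel summation *)

(** The alternating sign places the singularity of the summed series at [x = - 1 / e], away from
    [0, 1], so the integrand stays bounded up to [e = 1] although the coefficients may grow. *)
Lemma Abel_summable_moments (alpha M : R) (phi : R -> R) (m : nat -> R) :
  0 < alpha ->
  (forall x, 0 <= x <= 1 -> Rabs (phi x) <= M) ->
  (forall k, is_RInt (fun x => x ^ k * phi x) 0 1 (m k)) ->
  Abel_summable (fun k => (-1) ^ k * binom_coef alpha k * m k).
Proof.
  intros Ha HM Hm.
  assert (Hreg : forall i, alpha + INR i <> 0) by (intros i; pose proof (pos_INR i); lra).
  assert (HM0 : 0 <= M) by (apply Rle_trans with (2 := HM 0 ltac:(lra)), Rabs_pos).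
  assert (Hser : forall e, 0 < e < 1 ->
    exists J, is_series (fun k => (-1) ^ k * binom_coef alpha k * m k * e ^ k) J /\
      is_RInt (fun x => Rpower (1 + e * x) (- alpha) * phi x) 0 1 J).
  { intros e He.
    assert (Hdisk : forall y, Rabs y < 1 -> Rbar_lt (Rabs y) (CV_radius (binom_coef alpha)))
      by (intros y Hy; rewrite CV_radius_binom_coef; [exact Hy|exact Hreg]).
    (* The majorant converges because [e < 1]. At [e = 1] it would diverge for [M > 0], so the limit
       in [e] is taken only after summation. *)
    apply is_RInt_series with
      (f := fun k x => (-1) ^ k * binom_coef alpha k * e ^ k * (x ^ k * phi x))
      (M := fun k => Rabs (binom_coef alpha k * e ^ k) * M).
    - intros k x Hx. rewrite !Rabs_mult, pow_1_abs, Rmult_1_l.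
      apply Rmult_le_compat_l; [apply Rmult_le_pos; apply Rabs_pos|].
      rewrite <- (Rmult_1_l M).
      apply Rmult_le_compat; try apply Rabs_pos; [|apply HM, Hx].
      rewrite Rabs_pos_eq by (apply pow_le; lra).
      rewrite <- (pow1 k). apply pow_incr. lra.
    - apply ex_series_scal_r, CV_disk_inside, Hdisk.
      rewrite Rabs_pos_eq; lra.
    - intros x Hx.
      assert (Hex : Rabs (- (e * x)) < 1).
      { rewrite Rabs_Ropp, Rabs_pos_eq; nra. }
      replace (1 + e * x) with (1 - (- (e * x))) by ring.
      rewrite <- PSeries_binom_coef by assumption.
      apply is_series_ext with
        (fun k => (binom_coef alpha k * (- (e * x)) ^ k) * phi x).
      + intros k. replace (- (e * x)) with (-1 * (e * x)) by ring.
        rewrite !Rpow_mult_distr. match goal with |- ?l = ?r => change (@eq R l r) end. ring.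
      + apply is_series_scal_r.
        apply is_pseries_R, PSeries_correct, CV_radius_inside, Hdisk, Hex.
    - intros k.
      replace ((-1) ^ k * binom_coef alpha k * m k * e ^ k) with
        ((-1) ^ k * binom_coef alpha k * e ^ k * m k) by ring.
      apply (@is_RInt_scal R_NormedModule), Hm. }
  split.
  - intros e He. destruct (Hser e He) as [J [HJ _]]. now exists J.
  - set (h := fun e => Series _).
    destruct (is_RInt_uniform_limit (at_left 1)
      (fun e x => Rpower (1 + e * x) (- alpha) * phi x)
      (fun x => Rpower (1 + x) (- alpha) * phi x) h) as [l [Hl _]]; [| |now exists l].
    + exists (mkposreal _ Rlt_0_1). intros e He Hlt.
      change (Rabs (e - 1) < 1) in He. apply Rabs_lt_between in He.
      destruct (Hser e ltac:(lra)) as [J [HJ HI]].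
      unfold h. now rewrite (is_series_unique _ _ HJ).
    + intros d.
      (* [e (1 + x) <= 1 + e x <= 1 + x] squeezes the two powers
         within a factor [e ^ (- alpha)]. *)
      assert (Hpow : at_left 1 (fun e => (Rpower e (- alpha) - 1) * (M + 1) < d)).
      { apply filter_le_within.
        assert (Hc : continuous (fun e => (Rpower e (- alpha) - 1) * (M + 1)) 1).
        { apply (@ex_derive_continuous R_AbsRing R_NormedModule). unfold Rpower. auto_derive. lra. }
        assert (Hz : (Rpower 1 (- alpha) - 1) * (M + 1) = 0).
        { unfold Rpower. rewrite ln_1, Rmult_0_r, exp_0. ring. }
        generalize (proj1 (filterlim_locally _ _) Hc d). apply filter_imp.
        intros e He. cbv beta in He. rewrite Hz in He.
        change (Rabs ((Rpower e (- alpha) - 1) * (M + 1) - 0) < d) in He.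
        apply Rabs_lt_between in He. lra. }
      assert (Hgt : at_left 1 (fun e => 0 < e < 1)).
      { exists (mkposreal _ Rlt_0_1). intros e He Hlt.
        change (Rabs (e - 1) < 1) in He. apply Rabs_lt_between in He. lra. }
      generalize (filter_and _ _ Hpow Hgt). apply filter_imp.
      intros e [He H01] x Hx.
      rewrite <- Rmult_minus_distr_r, Rabs_mult.
      assert (Hanti : forall y1 y2, 0 < y1 <= y2 -> Rpower y2 (- alpha) <= Rpower y1 (- alpha)).
      { intros y1 y2 Hy. rewrite !Rpower_Ropp. apply Rinv_le_contravar.
        - apply exp_pos.
        - apply Rle_Rpower_l; lra. }
      pose proof (Hanti (1 + e * x) (1 + x) ltac:(nra)) as E1.
      pose proof (Hanti (e * (1 + x)) (1 + e * x) ltac:(nra)) as E2.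
      rewrite <- Rpower_mult_distr in E2 by lra.
      pose proof (Hanti 1 (1 + x) ltac:(lra)) as E3.
      pose proof (Hanti e 1 ltac:(lra)) as E4.
      assert (R1 : Rpower 1 (- alpha) = 1) by (unfold Rpower; rewrite ln_1, Rmult_0_r, exp_0; ring).
      rewrite R1 in E3, E4.
      rewrite Rabs_pos_eq by lra.
      pose proof (HM x Hx). pose proof (Rabs_pos (phi x)).
      (* The difference of the powers is at most [(e ^ (- alpha) - 1) * (1 + x) ^ (- alpha)], and
         the last factor is at most 1. *)
      apply Rle_lt_trans with (2 := He). apply Rmult_le_compat; try lra.
      assert (0 < Rpower (1 + x) (- alpha)) by apply exp_pos.
      nra.
Qed.

Theorem theorem4p3 (a b s : R) (hab : a >= b) (hb : b > 0) (hs : 0 < s < 1) :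
  Abel_summable (L_minus_term a b s).
Proof.
  set (K := 2 * sqrt (a ^ 2 + b ^ 2) / (1 - s)).
  (* This exponent makes [(k + 1) / r] equal to [u_minus s k]. *)
  set (r := 2 * (1 - s) / s).
  set (z1 := b ^ 2 / (a ^ 2 + b ^ 2)). set (z2 := a ^ 2 / (a ^ 2 + b ^ 2)).
  assert (Hr : 0 < r) by (apply Rdiv_lt_0_compat; lra).
  assert (Halpha : 0 < alpha s)
    by (unfold alpha; pose proof (Rdiv_lt_0_compat 1 s ltac:(lra) ltac:(lra)); lra).
  (* Both squares being positive, the two hypergeometric arguments are strictly below 1, inside the
     disk of convergence. *)
  assert (Ha2 : 0 < a ^ 2) by (apply pow_lt; lra).
  assert (Hb2 : 0 < b ^ 2) by (apply pow_lt; lra).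
  assert (Hz1 : 0 <= z1 < 1).
  { unfold z1. split; [apply Rlt_le, Rdiv_lt_0_compat; lra|].
    apply Rmult_lt_reg_r with (a ^ 2 + b ^ 2); [lra|]. field_simplify; lra. }
  assert (Hz2 : 0 <= z2 < 1).
  { unfold z2. split; [apply Rlt_le, Rdiv_lt_0_compat; lra|].
    apply Rmult_lt_reg_r with (a ^ 2 + b ^ 2); [lra|]. field_simplify; lra. }
  assert (Hhalf : forall m, - (1 / 2) + INR m <> 0).
  { intros [|m]; [simpl; lra|]. rewrite S_INR. pose proof (pos_INR m). lra. }
  destruct (euler_kernel_bound (- (1 / 2)) r z1 Hhalf Hr Hz1) as [M1 HM1].
  destruct (euler_kernel_bound (- (1 / 2)) r z2 Hhalf Hr Hz2) as [M2 HM2].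
  (* Since [1 / u_k = r / (k + 1)], each term takes the quotient by [k + 1] given by the moment
     formula, and [r] joins the constant [K]. *)
  replace (L_minus_term a b s) with (fun k : nat =>
    (-1) ^ k * binom_coef (alpha s) k * (K * r *
      (hypergeom2F1 (- (1 / 2)) 1 ((INR k + 1) / r + 1) z1 / (INR k + 1) +
       hypergeom2F1 (- (1 / 2)) 1 ((INR k + 1) / r + 1) z2 / (INR k + 1)))).
  - apply (Abel_summable_moments (alpha s) (Rabs (K * r) * (M1 + M2)) (fun x =>
      K * r * (euler_kernel (- (1 / 2)) r z1 x + euler_kernel (- (1 / 2)) r z2 x)));
      [exact Halpha| |].
    + intros x Hx. rewrite Rabs_mult. apply Rmult_le_compat_l; [apply Rabs_pos|].
      apply Rle_trans with (1 := Rabs_triang _ _). specialize (HM1 x Hx).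
      specialize (HM2 x Hx). lra.
    + intros k.
      apply is_RInt_ext with (fun x => K * r *
        (x ^ k * euler_kernel (- (1 / 2)) r z1 x + x ^ k * euler_kernel (- (1 / 2)) r z2 x)).
      { intros x _. match goal with |- ?l = ?r => change (@eq R l r) end. ring. }
      apply (@is_RInt_scal R_NormedModule), (@is_RInt_plus R_NormedModule);
        apply hypergeom2F1_euler_moment; assumption.
  - apply functional_extensionality. intros k. unfold L_minus_term. fold K z1 z2.
    pose proof (pos_INR k) as Hk. pose proof (INR_fact_neq_0 k) as Hf.
    rewrite pochhammer_rising by (intros m; pose proof (pos_INR m); lra).
    replace ((INR k + 1) / r) with (u_minus s k) by (unfold u_minus, r; field; lra).
    replace r with ((INR k + 1) / u_minus s k) by (unfold u_minus, r; field; lra).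
    unfold binom_coef. field. repeat split; try lra.
    unfold u_minus. apply Rgt_not_eq, Rdiv_lt_0_compat; nra.
Qed.
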